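(* For every $n\in\mathbb{N}$, $n\ge 1$, the algebra $A=M_n(\mathbb{C})$ of complex $n\times n$ matrices is ternary weakly amenable (as a JB$^*$-triple with $\{a,b,c\}=\frac12(ab^*c+cb^*a)$) and Jordan weakly amenable (as a Jordan Banach algebra with $a\circ b=\frac12(ab+ba)$).
   Context: Ternary weak amenability. The dual $A^*$ is a Jordan triple $A$-module with the products $\{a,b,\varphi\}(x)=\{\varphi,b,a\}(x):=\varphi(\{b,a,x\})$ and $\{a,\varphi,b\}(x):=\overline{\varphi(\{a,x,b\})}$ for $a,b,x\in A$, $\varphi\in A^*$. A ternary derivation $\delta:A\to A^*$ is a conjugate linear map with $\delta\{a,b,c\}=\{\delta(a),b,c\}+\{a,\delta(b),c\}+\{a,b,\delta(c)\}$ for all $a,b,c\in A$. For $b\in A$, $\varphi\in A^*$, put $\delta(b,\varphi)(a):=\{b,\varphi,a\}-\{\varphi,b,a\}$; finite sums of such maps are called inner ternary derivations. $A$ is ternary weakly amenable if every continuous ternary derivation $A\to A^*$ is inner. Jordan weak amenability. $A^*$ is a Jordan $A$-module via $(a\circ\varphi)(b)=(\varphi\circ a)(b)=\varphi(a\circ b)$. A Jordan derivation $D:A\to A^*$ is a linear map with $D(a\circ b)=D(a)\circ b+a\circ D(b)$. For $\varphi\in A^*$, $b\in A$, put $\delta_{\varphi,b}(a):=(\varphi\circ a)\circ b-(b\circ a)\circ\varphi$; finite sums of such maps are called inner Jordan derivations. $A$ is Jordan weakly amenable if every bounded Jordan derivation $A\to A^*$ is inner. *)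

(* Defs.v *)
From HB Require Import structures.
From mathcomp Require Import all_boot all_order all_algebra.
From mathcomp Require Import complex.
From mathcomp Require Import boolp classical_sets functions reals topology.
From mathcomp Require Import normedtype.

Set Implicit Arguments.
Unset Strict Implicit.
Unset Printing Implicit Defensive.

Import Order.TTheory GRing.Theory Num.Theory.
Import numFieldNormedType.Exports.
Import Normc.

Local Open Scope classical_set_scope.
Local Open Scope complex_scope.
Local Open Scope sesquilinear_scope.
Local Open Scope ring_scope.

(* Suprema over a unit ball [p x <= 1]; used for both the operator norm of
   matrices and the norm of the dual. *)
Section BallSup.
Variables (R : realType) (U : Type) (u0 : U) (p : U -> R).
Hypothesis pu0 : p u0 <= 1.

Definition ball_sup (g : U -> R) : R := sup [set g x | x in [set x | p x <= 1]].

Definition ball_bounded (g : U -> R) := exists k, forall x, p x <= 1 -> g x <= k.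

Lemma ball_sup_ub g x : ball_bounded g -> p x <= 1 -> g x <= ball_sup g.
Proof.
move=> [k gk] px; apply: ub_le_sup; last by exists x.
by exists k => _ [y /= py <-]; exact: gk.
Qed.

Lemma ball_sup_le g k : (forall x, p x <= 1 -> g x <= k) -> ball_sup g <= k.
Proof.
move=> gk; apply: ge_sup; first by exists (g u0), u0.
by move=> _ [x /= px <-]; exact: gk.
Qed.

Lemma ball_supD g g1 g2 : ball_bounded g1 -> ball_bounded g2 ->
  (forall x, g x <= g1 x + g2 x) -> ball_sup g <= ball_sup g1 + ball_sup g2.
Proof.
move=> b1 b2 gD; apply: ball_sup_le => x px; apply: le_trans (gD x) _.
by apply: lerD; exact: ball_sup_ub.
Qed.

Lemma ball_supZ g1 g2 k : 0 <= k -> ball_bounded g1 -> (forall x, 0 <= g1 x) ->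
  (forall x, g2 x = k * g1 x) -> ball_sup g2 = k * ball_sup g1.
Proof.
move=> k0 b1 g10 g2E; have b2 : ball_bounded g2.
  case: b1 => c gc; exists (k * c) => x px.
  by rewrite g2E ler_wpM2l// gc.
apply/eqP; rewrite eq_le; apply/andP; split.
  by apply: ball_sup_le => x px; rewrite g2E ler_wpM2l// ball_sup_ub.
have [k0E|kN0] := eqVneq k 0.
  rewrite k0E mul0r; apply: le_trans (ball_sup_ub b2 pu0).
  by rewrite g2E k0E mul0r.
have {}k0 : 0 < k by rewrite lt_neqAle eq_sym kN0.
rewrite mulrC -ler_pdivlMr//; apply: ball_sup_le => x px.
by rewrite ler_pdivlMr// mulrC -g2E ball_sup_ub.
Qed.

Lemma ball_sup_eq0 g x : ball_bounded g -> (forall x, 0 <= g x) ->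
  ball_sup g = 0 -> p x <= 1 -> g x = 0.
Proof.
move=> b g0 s0 px; apply/eqP; rewrite eq_le g0 andbT -s0.
exact: ball_sup_ub.
Qed.

End BallSup.

Section Normc.
Variable R : realType.
Implicit Types x y : R[i].

Lemma normcC x : (normc x)%:C = `|x|.
Proof. by []. Qed.

Lemma normc_ge0 x : 0 <= normc x.
Proof. by case: x => a b; rewrite /normc sqrtr_ge0. Qed.

End Normc.

Section TopologicalDual.
Variables (R : realType) (A : normedModType R[i]).

Definition dual_pred : {pred (A -> R[i]^o)} :=
  [pred f : A -> R[i]^o | `[< linear f /\ continuous f >]].

Record dual := Dual { dual_fun :> A -> R[i]^o; _ : dual_fun \in dual_pred }.

HB.instance Definition _ := [isSub for dual_fun].
HB.instance Definition _ := [Choice of dual by <:].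

Lemma dual_linear (phi : dual) : linear phi.
Proof. by case: phi => f /= /asboolP[]. Qed.

Lemma dual_continuous (phi : dual) : continuous (phi : A -> R[i]^o).
Proof. by case: phi => f /= /asboolP[]. Qed.

Lemma dual_predP (f : A -> R[i]^o) :
  linear f -> continuous f -> f \in dual_pred.
Proof. by move=> lf cf; apply/asboolP. Qed.

Lemma dual_submod_closed : submod_closed dual_pred.
Proof.
split=> [|k f g /asboolP[lf cf] /asboolP[lg cg]].
  apply: dual_predP => [a x y|]; first by rewrite /= scaler0 addr0.
  exact: cst_continuous.
apply: dual_predP.
  move=> a x y.
  change (k *: f (a *: x + y) + g (a *: x + y)
          = a *: (k *: f x + g x) + (k *: f y + g y)).
  by rewrite lf lg !scalerDr !scalerA (mulrC k) addrACA.
move=> x; change (continuous_at x (fun x => k *: f x + g x)).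
apply: cvgD; last exact: cg.
by apply: cvgZr; exact: cf.
Qed.

HB.instance Definition _ :=
  GRing.isSubmodClosed.Build _ _ dual_pred dual_submod_closed.
HB.instance Definition _ := [SubChoice_isSubLmodule of dual by <:].

Lemma dualDE (f g : dual) x : (f + g) x = f x + g x.
Proof. by []. Qed.

Lemma dualZE k (f : dual) x : (k *: f) x = k * f x.
Proof. by []. Qed.

Lemma dual_eq (f g : dual) : (forall x, f x = g x) -> f = g.
Proof. by move=> fg; apply: val_inj; apply/funext. Qed.

Lemma dual_normD (f : dual) x y : `|f (x + y)| <= `|f x| + `|f y|.
Proof.
by have := dual_linear f 1 x y; rewrite !scale1r => ->; exact: ler_normD.
Qed.

Lemma dual_scale (f : dual) k x : f (k *: x) = k * f x.
Proof.
have f0 : f 0 = 0.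
  have /eqP := dual_linear f 1 0 0.
  by rewrite !scale1r addr0 -{1}[f 0]addr0 => /eqP/addrI.
by have := dual_linear f k x 0; rewrite !addr0 f0 addr0.
Qed.

Let unit_gauge (x : A) : R := complex.Re `|x|.

Let unit_gaugeE x : (unit_gauge x)%:C = `|x|.
Proof. by rewrite /unit_gauge RRe_real// normr_real. Qed.

Lemma unit_gaugeP x : (unit_gauge x <= 1) = (`|x| <= 1).
Proof. by rewrite -unit_gaugeE -lecR. Qed.

Let unit_gauge0 : unit_gauge 0 <= 1.
Proof. by rewrite unit_gaugeP normr0. Qed.

Definition dual_norm (phi : dual) : R :=
  sup [set normc (phi x) | x in [set x : A | `|x| <= 1]].

Lemma dual_normE (phi : dual) :
  dual_norm phi = ball_sup unit_gauge (fun x => normc (phi x)).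
Proof.
rewrite /dual_norm /ball_sup; congr (sup (_ @` _)).
by apply/funext => x /=; rewrite unit_gaugeP.
Qed.

Lemma dual_bounded (phi : dual) :
  exists2 k : R, 0 <= k & forall x, `|phi x| <= k%:C * `|x|.
Proof.
pose B := GRing.isLinear.Build _ _ _ _ (phi : A -> R[i]^o) (dual_linear phi).
pose L : {linear A -> R[i]^o} := HB.pack (phi : A -> R[i]^o) B.
have : continuous L by exact: dual_continuous.
move=> /linear_bounded_continuous/linear_boundedP/pinfty_ex_gt0[r r0 Lr].
have rE : (complex.Re r)%:C = r by rewrite RRe_real// gtr0_real.
exists (complex.Re r); first by rewrite -lecR rE ltW.
by move=> x; rewrite rE; exact: Lr.
Qed.

Let dual_ball_bounded (phi : dual) :
  ball_bounded unit_gauge (fun x => normc (phi x)).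
Proof.
have [k k0 phik] := dual_bounded phi.
exists k => x; rewrite unit_gaugeP -lecR => x1.
rewrite normcC; apply: le_trans (phik x) _.
by rewrite -[leRHS]mulr1 ler_wpM2l// lecR.
Qed.

Lemma dual_norm_triangle phi psi :
  (dual_norm (phi + psi))%:C <= (dual_norm phi)%:C + (dual_norm psi)%:C.
Proof.
rewrite -rmorphD lecR !dual_normE.
apply: (ball_supD unit_gauge0) => // x.
exact: le_normcD.
Qed.

Lemma dual_norm_scale k phi :
  (dual_norm (k *: phi))%:C = `|k| * (dual_norm phi)%:C.
Proof.
rewrite -normcC -rmorphM; congr (_%:C); rewrite !dual_normE.
apply: (ball_supZ unit_gauge0) => //; first exact: normc_ge0.
  by move=> x; exact: normc_ge0.
by move=> x; exact: normcM.
Qed.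

Lemma dual_norm_eq0 phi : (dual_norm phi)%:C = 0 -> phi = 0.
Proof.
move=> /complexI; rewrite dual_normE => p0; apply: dual_eq => x.
have p1 y : `|y| <= 1 -> phi y = 0.
  move=> y1; apply: eq0_normc.
  apply: (@ball_sup_eq0 _ _ _ (fun x => normc (phi x)) y _ _ p0) => //.
    by move=> z; exact: normc_ge0.
  by rewrite unit_gaugeP.
have [->|x0] := eqVneq x 0; first by rewrite p1// normr0.
have nx0 : `|x| != 0 by rewrite normr_eq0.
have := @p1 (`|x|^-1 *: x); rewrite dual_scale normrZ normfV normr_id mulVf//.
move=> /(_ (lexx _))/eqP; rewrite mulf_eq0 invr_eq0 (negPf nx0) /=.
by move=> /eqP.
Qed.

HB.instance Definition _ := Lmodule_isNormed.Build R[i] dual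
  dual_norm_triangle dual_norm_scale dual_norm_eq0.

Lemma dual_normrE (phi : dual) : `|phi| = (dual_norm phi)%:C.
Proof. by []. Qed.

End TopologicalDual.

Section OperatorNorm.
Variables (R : realType).

(* Euclidean norm *)
Definition l2norm n (v : 'cV[R[i]]_n) : R :=
  Num.sqrt (\sum_(i < n) normc (v i 0) ^+ 2).

Lemma l2norm_ge0 n (v : 'cV[R[i]]_n) : 0 <= l2norm v.
Proof. exact: sqrtr_ge0. Qed.

Lemma l2norm_sqr n (v : 'cV[R[i]]_n) :
  l2norm v ^+ 2 = \sum_(i < n) normc (v i 0) ^+ 2.
Proof. by rewrite sqr_sqrtr// sumr_ge0// => i _; rewrite sqr_ge0. Qed.

Lemma l2normC n (v : 'cV[R[i]]_n) : (l2norm v)%:C = sqrtC (dotmx v^T v^T).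
Proof.
have -> : dotmx v^T v^T = (l2norm v)%:C ^+ 2.
  rewrite -rmorphXn l2norm_sqr rmorph_sum dotmxE mxE; apply: eq_bigr => i _.
  by rewrite rmorphXn /= normcC !mxE normCK.
by rewrite sqrCK// lecR l2norm_ge0.
Qed.

Lemma l2normD n (u v : 'cV[R[i]]_n) : l2norm (u + v) <= l2norm u + l2norm v.
Proof.
rewrite -lecR rmorphD /= !l2normC linearD /=.
by have [] := triangle_lerif (@dotmx R[i] n) u^T v^T.
Qed.

Lemma l2normZ n k (v : 'cV[R[i]]_n) : l2norm (k *: v) = normc k * l2norm v.
Proof.
rewrite /l2norm -[normc k in RHS](ger0_norm (normc_ge0 _)) -sqrtr_sqr.
rewrite -sqrtrM ?sqr_ge0// mulr_sumr; congr Num.sqrt.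
by apply: eq_bigr => i _; rewrite mxE normcM exprMn.
Qed.

Lemma l2norm0 n : l2norm (0 : 'cV[R[i]]_n) = 0.
Proof. by rewrite -(scale0r 0) l2normZ normc0 mul0r. Qed.

Lemma l2norm_entry n (v : 'cV[R[i]]_n) i : normc (v i 0) <= l2norm v.
Proof.
rewrite -(ler_sqr (normc_ge0 _) (l2norm_ge0 _)) l2norm_sqr (bigD1 i)//=.
by rewrite lerDl sumr_ge0// => j _; rewrite sqr_ge0.
Qed.

Lemma l2norm_eq0 n (v : 'cV[R[i]]_n) : l2norm v = 0 -> v = 0.
Proof.
move=> v0; apply/colP => i; rewrite mxE; apply: eq0_normc.
by apply/eqP; rewrite eq_le normc_ge0 andbT -v0 l2norm_entry.
Qed.

Lemma l2norm_delta n (j : 'I_n) : l2norm (delta_mx j 0) = 1.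
Proof.
rewrite /l2norm (bigD1 j)//= mxE !eqxx normc1 expr1n big1 ?addr0 ?sqrtr1//.
by move=> i /negPf ij; rewrite mxE ij normc0 expr0n.
Qed.

Lemma l2norm_sum n I (s : seq I) (F : I -> 'cV[R[i]]_n) :
  l2norm (\sum_(i <- s) F i) <= \sum_(i <- s) l2norm (F i).
Proof.
elim: s => [|i s ih]; first by rewrite !big_nil l2norm0.
by rewrite !big_cons (le_trans (l2normD _ _))// lerD2l.
Qed.

(* The C*-norm of M_n(C): the norm of M as an operator on Euclidean C^n *)
Definition opnorm n (M : 'M[R[i]]_n) : R :=
  sup [set l2norm (M *m v) | v in [set v : 'cV[R[i]]_n | l2norm v <= 1]].

Let l2norm01 n : l2norm (0 : 'cV[R[i]]_n) <= 1.
Proof. by rewrite l2norm0. Qed.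

Let opnorm_ball_bounded n (M : 'M[R[i]]_n) :
  ball_bounded (@l2norm n) (fun v => l2norm (M *m v)).
Proof.
exists (\sum_j l2norm (col j M)) => v v1.
have -> : M *m v = \sum_j v j 0 *: col j M.
  by apply/colP => i; rewrite mxE summxE; apply: eq_bigr => j _;
     rewrite !mxE mulrC.
apply: le_trans (l2norm_sum _ _) _; apply: ler_sum => j _.
rewrite l2normZ -[leRHS]mul1r ler_wpM2r ?l2norm_ge0//.
exact: le_trans (l2norm_entry v j) v1.
Qed.

Lemma opnorm_ub n (M : 'M[R[i]]_n) v :
  l2norm v <= 1 -> l2norm (M *m v) <= opnorm M.
Proof.
have b := opnorm_ball_bounded M.
exact: (@ball_sup_ub _ _ _ (fun v => l2norm (M *m v)) v b).
Qed.

Lemma opnorm_entry n (M : 'M[R[i]]_n) i j : normc (M i j) <= opnorm M.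
Proof.
apply: le_trans (opnorm_ub M (v := delta_mx j 0) _); last first.
  by rewrite l2norm_delta.
by rewrite -colE; have := l2norm_entry (col j M) i; rewrite mxE.
Qed.

Lemma opnormD n (M N : 'M[R[i]]_n) :
  (opnorm (M + N))%:C <= (opnorm M)%:C + (opnorm N)%:C.
Proof.
rewrite -rmorphD lecR; apply: (ball_supD (l2norm01 n) (opnorm_ball_bounded M)
          (opnorm_ball_bounded N)) => v.
by rewrite mulmxDl l2normD.
Qed.

Lemma opnormZ n k (M : 'M[R[i]]_n) :
  (opnorm (k *: M))%:C = `|k| * (opnorm M)%:C.
Proof.
rewrite -normcC -rmorphM; congr (_%:C).
apply: (ball_supZ (l2norm01 n) _ (opnorm_ball_bounded M)).
- exact: normc_ge0.
- by move=> v; exact: l2norm_ge0.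
by move=> v; rewrite -scalemxAl l2normZ.
Qed.

Lemma opnorm_eq0 n (M : 'M[R[i]]_n) : (opnorm M)%:C = 0 -> M = 0.
Proof.
move=> /complexI M0; apply/matrixP => i j; rewrite mxE; apply: eq0_normc.
by apply/eqP; rewrite eq_le normc_ge0 andbT -M0 opnorm_entry.
Qed.

End OperatorNorm.

(* An alias of 'M[R[i]]_n carrying the operator norm, since the library puts
   the entrywise sup norm on 'M[R[i]]_n itself. *)
Definition Mn (R : realType) (n : nat) : Type := 'M[R[i]]_n.

HB.instance Definition _ (R : realType) n :=
  GRing.Lmodule.copy (Mn R n) 'M[R[i]]_n.
HB.instance Definition _ (R : realType) n :=
  Lmodule_isNormed.Build R[i] (Mn R n)
  (@opnormD R n) (@opnormZ R n) (@opnorm_eq0 R n).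

Lemma Mn_normE (R : realType) n (a : Mn R n) : `|a| = (opnorm a)%:C.
Proof. by []. Qed.

Section MatrixProducts.
Variables (R : realType) (n : nat).

Definition Mn_triple (a b c : Mn R n) : Mn R n :=
  2^-1 *: (a *m b^t* *m c + c *m b^t* *m a).

Definition Mn_jordan (a b : Mn R n) : Mn R n := 2^-1 *: (a *m b + b *m a).

End MatrixProducts.

(* The module products below are plain functions A -> C: they are continuous
   functionals as soon as the product of A is continuous, but only their values
   matter. Equations between elements of the dual are thus stated between the
   underlying functions, with pointwise addition. *)

Section TernaryWeakAmenability.
Variables (R : realType) (A : normedModType R[i]) (tp : A -> A -> A -> A).

(* {phi, b, a} = {a, b, phi} *)
Definition triple_outer (phi : A -> R[i]^o) (b a : A) : A -> R[i]^o :=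
  fun x => phi (tp b a x).

(* {a, phi, b} *)
Definition triple_inner (a : A) (phi : A -> R[i]^o) (b : A) : A -> R[i]^o :=
  fun x => (phi (tp a x b))^*.

Definition ternary_derivation (delta : A -> dual A) : Prop :=
  (forall (k : R[i]) a b, delta (k *: a + b) = k^* *: delta a + delta b) /\
  forall a b c, delta (tp a b c) =
    triple_outer (delta a) b c + triple_inner a (delta b) c
    + triple_outer (delta c) b a :> (A -> R[i]^o).

Definition inner_ternary_derivation (delta : A -> dual A) : Prop :=
  exists s : seq (A * dual A), forall a, delta a =
    \sum_(p <- s) (triple_inner p.1 p.2 a - triple_outer p.2 p.1 a)
    :> (A -> R[i]^o).

Definition ternary_weakly_amenable : Prop :=
  forall delta : A -> dual A, ternary_derivation delta -> continuous delta ->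
  inner_ternary_derivation delta.

End TernaryWeakAmenability.

Section JordanWeakAmenability.
Variables (R : realType) (A : normedModType R[i]) (jp : A -> A -> A).

(* phi o a = a o phi *)
Definition jordan_act (phi : A -> R[i]^o) (a : A) : A -> R[i]^o :=
  fun x => phi (jp a x).

Definition jordan_derivation (D : {linear A -> dual A}) : Prop :=
  forall a b, D (jp a b) =
    jordan_act (D a) b + jordan_act (D b) a :> (A -> R[i]^o).

Definition inner_jordan_derivation (D : A -> dual A) : Prop :=
  exists s : seq (dual A * A), forall a, D a =
    \sum_(p <- s) (jordan_act (jordan_act p.1 a) p.2
                   - jordan_act p.1 (jp p.2 a))
    :> (A -> R[i]^o).

Definition jordan_weakly_amenable : Prop :=
  forall D : {linear A -> dual A}, jordan_derivation D ->
  (exists M : R, forall a, `|D a| <= M%:C * `|a|) ->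
  inner_jordan_derivation D.

End JordanWeakAmenability.

(* Main.v *)
Require Import Defs.
From HB Require Import structures.
From mathcomp Require Import all_boot all_order all_algebra.
From mathcomp Require Import complex ring.
From mathcomp Require Import boolp functions reals topology normedtype.

(** The trace form turns functionals on matrices into matrices, and under
    [phi x = \tr (m *m x)] the Jordan module [A^*] becomes [A] itself
    ([jordan_actE]); under the conjugate-linear [phi x = \tr (w^t* *m x)] the
    triple module [A^*] becomes [A] itself ([triple_outerE], [triple_innerE]), and
    conjugate-linear maps into [A^*] become linear maps into [A]. So a Jordan
    (resp. ternary) derivation into the dual is a Jordan (resp. triple)
    derivation [F] of the matrix algebra, and the claim is that such an [F] is a
    sum of inner ones.

    In both cases [F] satisfies the twisted rule
    [F (ac + ca) = F a c + c F a + a F c + F c a - a u c - c u a] with [u = F 1].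
    Put [a = E_ij], multiply by [E_ji] on the right and sum over [i] and [j].
    Since [\sum E_ij z E_ji] is the scalar [\tr z] and the tensor formed by the
    [E_ij] and [E_ji] commutes with matrices, nearly everything cancels, and with
    [H = \sum F (E_ij) E_ji] one gets [n F x = H x - x H + n x u]
    ([twisted_derivationE]). The same formula evaluates the mirror sum
    [\sum E_ji F (E_ij)] ([twisted_derivation_right]).

    These two facts make the sum of the inner derivations attached to the pairs
    formed by [F (E_ij)] and the matching matrix unit explicitly computable. For
    a Jordan derivation [u = 0] and the sum is a multiple of [F]
    ([jordan_derivation_casimir]). For a triple derivation it is a multiple of
    [F] plus the map [x |-> (\tr u) x]; as [u] is skew-adjoint, that map is itself
    inner, given by a scalar matrix and the trace functional
    ([triple_derivation_casimir]). As [F (E_ij)] represents the value of the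
    given derivation at [E_ij], that value is the functional to use, and the trace
    is the only functional whose continuity has to be proved. *)

Set Implicit Arguments.
Unset Strict Implicit.
Unset Printing Implicit Defensive.

Import Order.TTheory GRing.Theory Num.Theory.
Import numFieldNormedType.Exports.
Local Open Scope complex_scope.
Local Open Scope sesquilinear_scope.
Local Open Scope ring_scope.

(** * Contracting with matrix units *)

(** An equation follows from another one when the differences of their sides
    agree; this is how a hypothesis is passed to [ring]. *)
Lemma eq_by_sub (V : zmodType) (x y z t : V) : z = t -> x - y = z - t -> x = y.
Proof. by move=> ->; rewrite subrr => /eqP; rewrite subr_eq0 => /eqP. Qed.

Section Casimir.
Variables (K : numFieldType) (n : nat).
Implicit Types (x y : 'M[K]_n) (i j k : 'I_n) (p : 'I_n * 'I_n).

Notation E p := (delta_mx p.1 p.2 : 'M[K]_n).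
Notation E' p := (delta_mx p.2 p.1 : 'M[K]_n).

Lemma addmxE x y i j : (x + y) i j = x i j + y i j.
Proof. by rewrite mxE. Qed.

Lemma oppmxE x i j : (- x) i j = - x i j.
Proof. by rewrite mxE. Qed.

Lemma scalemxE c x i j : (c *: x) i j = c * x i j.
Proof. by rewrite mxE. Qed.

(** Unlike [mxE], this leaves the entries of products alone, so that [ring] can
    prove linear identities between noncommutative monomials. *)
Definition lin_mxE := (addmxE, oppmxE, scalemxE).

(** Matrix units are dual bases for the trace form, so sandwiching by them
    averages a matrix to a scalar. *)
Lemma sum_delta_sandwich x : \sum_p E p *m x *m E' p = (\tr x)%:M.
Proof.
rewrite -(pair_bigA _ (fun i j => delta_mx i j *m x *m delta_mx j i)) /=.
rewrite scalar_mx_sum_delta; apply: eq_bigr => i _; rewrite scaler_suml.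
apply: eq_bigr => j _; rewrite {1}[x]matrix_sum_delta mulmx_sumr mulmx_suml.
rewrite (bigD1 j) //= [X in _ + X]big1 ?addr0 => [|k kj].
  rewrite mulmx_sumr mulmx_suml (bigD1 j) //= [X in _ + X]big1 ?addr0 => [|k kj].
    by rewrite -scalemxAr -scalemxAl !mul_delta_mx.
  by rewrite -scalemxAr -scalemxAl -mulmxA mul_delta_mx_0 // mulmx0 scaler0.
rewrite mulmx_sumr mulmx_suml big1 // => l _.
by rewrite -scalemxAr mul_delta_mx_0 1?eq_sym // scaler0 mul0mx.
Qed.

Lemma sum_delta_sandwich' x : \sum_p E' p *m x *m E p = (\tr x)%:M.
Proof.
rewrite -sum_delta_sandwich (reindex (fun p => (p.2, p.1))) //=.
by exists (fun p => (p.2, p.1)) => -[].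
Qed.

Lemma sum_deltaK : \sum_p E p *m E' p = (n%:R)%:M.
Proof.
rewrite -(mxtrace1 K n) -sum_delta_sandwich.
by apply: eq_bigr => p _; rewrite mulmx1.
Qed.

Lemma sum_delta'K : \sum_p E' p *m E p = (n%:R)%:M.
Proof.
rewrite -(mxtrace1 K n) -sum_delta_sandwich'.
by apply: eq_bigr => p _; rewrite mulmx1.
Qed.

Lemma mulmx_delta x i j : x *m delta_mx i j = \sum_k x k i *: delta_mx k j.
Proof.
rewrite {1}[x]matrix_sum_delta mulmx_suml; apply: eq_bigr => k _.
rewrite mulmx_suml (bigD1 i) //= -scalemxAl mul_delta_mx big1 ?addr0 //.
by move=> m mi; rewrite -scalemxAl mul_delta_mx_0 ?scaler0.
Qed.

Lemma delta_mulmx x i j : delta_mx i j *m x = \sum_k x j k *: delta_mx i k.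
Proof.
rewrite {1}[x]matrix_sum_delta exchange_big mulmx_sumr; apply: eq_bigr => k _.
rewrite mulmx_sumr (bigD1 j) //= -scalemxAr mul_delta_mx big1 ?addr0 //.
by move=> m mj; rewrite -scalemxAr mul_delta_mx_0 ?scaler0 // eq_sym.
Qed.

Variable F : {linear 'M[K]_n -> 'M[K]_n}.

(** The tensor [\sum_p E p (x) E' p] commutes with matrices: a factor on the
    left of [E p] moves to the right of [E' p], and similarly on the inner side
    in [sum_delta_slider]. *)
Lemma sum_delta_slidel x :
  \sum_p F (x *m E p) *m E' p = (\sum_p F (E p) *m E' p) *m x.
Proof.
rewrite -(pair_bigA _ (fun i j => F (x *m delta_mx i j) *m delta_mx j i)) /=.
rewrite -(pair_bigA _ (fun i j => F (delta_mx i j) *m delta_mx j i)) /=.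
rewrite exchange_big [X in _ = X *m _]exchange_big mulmx_suml /=.
apply: eq_bigr => j _; rewrite mulmx_suml.
under eq_bigr => i _ do rewrite (mulmx_delta x) linear_sum mulmx_suml.
rewrite exchange_big /=; apply: eq_bigr => k _.
rewrite -mulmxA delta_mulmx mulmx_sumr; apply: eq_bigr => i _.
by rewrite linearZ /= -scalemxAl -scalemxAr.
Qed.

Lemma sum_delta_slider x :
  \sum_p F (E p *m x) *m E' p = \sum_p F (E p) *m x *m E' p.
Proof.
rewrite -(pair_bigA _ (fun i j => F (delta_mx i j *m x) *m delta_mx j i)) /=.
rewrite -(pair_bigA _ (fun i j => F (delta_mx i j) *m x *m delta_mx j i)) /=.
apply: eq_bigr => i _.
under eq_bigr => j _ do rewrite delta_mulmx linear_sum mulmx_suml.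
rewrite exchange_big /=; apply: eq_bigr => l _.
rewrite -mulmxA mulmx_delta mulmx_sumr; apply: eq_bigr => j _.
by rewrite linearZ /= -scalemxAl -scalemxAr.
Qed.

Let u := F 1%:M.
Let H := \sum_p F (E p) *m E' p.
Let H' := \sum_p E' p *m F (E p).

Hypothesis n_gt0 : (0 < n)%N.

(** The rule that a Jordan derivation satisfies, corrected by the value of [F]
    at the unit. It covers two cases at once: Jordan derivations, which kill the
    unit, and triple derivations, whose value there is skew-adjoint. *)
Hypothesis F_der : forall a c,
  F (a *m c + c *m a) = F a *m c + c *m F a + a *m F c + F c *m a
                        - a *m u *m c - c *m u *m a.

(** This is [F_der] at [a = E p], multiplied by [E' p] on the right and summed:
    the sum of the [F (E p) *m x *m E' p] occurs on both sides and cancels, by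
    [sum_delta_slider]. *)
Let contraction x :
  n%:R *: F x = H *m x - x *m H + n%:R *: (x *m u) - (\tr (F x - u *m x))%:M.
Proof.
have : \sum_p F (E p *m x + x *m E p) *m E' p =
  \sum_p (F (E p) *m x *m E' p + x *m (F (E p) *m E' p) +
          E p *m F x *m E' p + F x *m (E p *m E' p) -
          E p *m (u *m x) *m E' p - x *m u *m (E p *m E' p)).
  by apply: eq_bigr => p _; rewrite F_der !(mulmxDl, mulNmx) !mulmxA.
under eq_bigr => p _ do rewrite linearD mulmxDl.
rewrite !(big_split, sumrN) /= sum_delta_slidel sum_delta_slider -!mulmx_sumr.
rewrite !sum_delta_sandwich !sum_deltaK !mul_mx_scalar raddfB /= => /matrixP eqF.
apply/matrixP => i j; move: (eqF i j); rewrite !raddfB !lin_mxE -/H.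
by move=> e; apply: (eq_by_sub (esym e)); ring.
Qed.

(** Taking traces in the contracted identity kills its scalar term. What is left
    says that [F] is a commutator plus a right multiplication. *)
Lemma twisted_derivationE x :
  n%:R *: F x = H *m x - x *m H + n%:R *: (x *m u).
Proof.
suff tr0 : \tr (F x - u *m x) = 0.
  by rewrite contraction tr0 raddf0 subr0.
have n0 : 2%:R * n%:R != 0 :> K by rewrite mulf_eq0 !pnatr_eq0 -lt0n n_gt0.
apply: (mulfI n0); rewrite mulr0; have := contraction x.
set t := \tr _ => /(congr1 mxtrace); rewrite raddfB !raddfD raddfN /=.
rewrite !mxtraceZ mxtrace_scalar (mxtrace_mulC H) subrr add0r (mxtrace_mulC x).
rewrite -mulr_natr => e; apply: (eq_by_sub e).
by rewrite /t raddfB /=; ring.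
Qed.

(** Apply [twisted_derivationE] to the [F (E p)] that occur in [H]. *)
Let trH : \tr H = n%:R * \tr u.
Proof.
have n0 : n%:R != 0 :> K by rewrite pnatr_eq0 -lt0n.
have : n%:R *: H = \sum_p (n%:R *: F (E p)) *m E' p.
  by rewrite scaler_sumr; apply: eq_bigr => p _; rewrite scalemxAl.
under eq_bigr => p _ do
  rewrite twisted_derivationE mulmxDl mulmxBl -scalemxAl -(mulmxA H).
rewrite !(big_split, sumrN) /= -mulmx_sumr sum_deltaK -scaler_sumr.
rewrite !sum_delta_sandwich.
rewrite mul_mx_scalar => /matrixP/(_ (Ordinal n_gt0) (Ordinal n_gt0)).
rewrite !lin_mxE ![_%:M _ _]mxE eqxx !mulr1n => e.
by apply: (eq_by_sub e); ring.
Qed.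

(** The mirrored contraction gives nothing new: it is determined by [H] and
    [F 1]. *)
Lemma twisted_derivation_right : H' = n%:R *: u - H + (\tr u)%:M.
Proof.
have n0 : n%:R != 0 :> K by rewrite pnatr_eq0 -lt0n.
apply: (scalerI n0).
have -> : n%:R *: H' = \sum_p E' p *m (n%:R *: F (E p)).
  by rewrite scaler_sumr; apply: eq_bigr => p _; rewrite scalemxAr.
under eq_bigr => p _ do
  rewrite twisted_derivationE mulmxDr mulmxBr -scalemxAr !mulmxA.
rewrite !(big_split, sumrN) /= -mulmx_suml -scaler_sumr -mulmx_suml.
rewrite !sum_delta'K sum_delta_sandwich' trH !mul_scalar_mx.
by rewrite !(scalerDr, scalerN) -scale_scalar_mx addrC addrA [LHS]addrAC.
Qed.
End Casimir.

(** * Jordan derivations of matrices *)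

Section JordanMatrix.
Variables (K : numFieldType) (n : nat).
Implicit Types (m a b x : 'M[K]_n) (p : 'I_n * 'I_n).

Notation E p := (delta_mx p.1 p.2 : 'M[K]_n).
Notation E' p := (delta_mx p.2 p.1 : 'M[K]_n).

Definition jmul a b : 'M[K]_n := 2^-1 *: (a *m b + b *m a).

Lemma mxtrace_mulBl a b x : \tr ((a - b) *m x) = \tr (a *m x) - \tr (b *m x).
Proof. by rewrite mulmxBl raddfB. Qed.

Lemma jmulZl k a b : jmul (k *: a) b = k *: jmul a b.
Proof.
by rewrite /jmul -scalemxAl -scalemxAr -scalerDr scalerA mulrC -scalerA.
Qed.

Lemma mxtrace_jmul m a x : \tr (m *m jmul a x) = \tr (jmul m a *m x).
Proof.
rewrite -scalemxAr -scalemxAl !mxtraceZ mulmxDl mulmxDr !raddfD /=.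
congr (_ * (_ + _)); first by rewrite mulmxA.
by rewrite mulmxA mxtrace_mulC mulmxA.
Qed.

Lemma jmul_associator m a b :
  jmul (jmul m a) b - jmul m (jmul b a) =
  4^-1 *: (a *m (m *m b - b *m m) - (m *m b - b *m m) *m a).
Proof.
rewrite /jmul -!(scalemxAl, scalemxAr) !(mulmxDl, mulmxDr, mulmxN, mulNmx).
rewrite !mulmxA; apply/matrixP => i j; rewrite !lin_mxE.
by field.
Qed.

Variable F : {linear 'M[K]_n -> 'M[K]_n}.
Hypothesis n_gt0 : (0 < n)%N.
Hypothesis F_jordan : forall a b, F (jmul a b) = jmul (F a) b + jmul (F b) a.

Let F_mul a b :
  F (a *m b + b *m a) = F a *m b + b *m F a + a *m F b + F b *m a.
Proof.
have two0 : 2%:R != 0 :> K by rewrite pnatr_eq0.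
apply: (scalerI (invr_neq0 two0)); rewrite -linearZ F_jordan /jmul -scalerDr.
by rewrite [F b *m a + _]addrC !addrA.
Qed.

Let F1 : F 1%:M = 0.
Proof.
have := F_mul 1%:M 1%:M.
rewrite !mul1mx !mulmx1 linearD -[LHS]addr0 -[RHS]addrA => /addrI/esym/eqP.
by rewrite -mulr2n -scaler_nat scaler_eq0 pnatr_eq0 => /eqP.
Qed.

(** The associators here are commutators with [m *m b - b *m m], by
    [jmul_associator]. As [F 1 = 0], [twisted_derivation_right] says that for
    [m = F (E p)] and [b = E' p] these matrices add up to twice the [H] of
    [twisted_derivationE], so the associators add up to [- (n / 2) F]. *)
Lemma jordan_derivation_casimir a :
  F a = \sum_p (jmul (jmul (- (2 / n%:R) *: F (E p)) a) (E' p)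
                - jmul (- (2 / n%:R) *: F (E p)) (jmul (E' p) a)).
Proof.
have n0 : n%:R != 0 :> K by rewrite pnatr_eq0 -lt0n.
have F_der b c : F (b *m c + c *m b) =
    F b *m c + c *m F b + b *m F c + F c *m b
    - b *m F 1%:M *m c - c *m F 1%:M *m b.
  by rewrite F_mul F1 !mulmx0 !mul0mx !subr0.
have := twisted_derivationE n_gt0 F_der a.
have := twisted_derivation_right n_gt0 F_der.
rewrite F1 scaler0 add0r linear0 raddf0 addr0 mulmx0 scaler0 addr0.
set H := \sum_p F (E p) *m E' p => HE FE.
under eq_bigr => p _ do
  rewrite !(jmulZl (- (2 / n%:R))) -scalerBr jmul_associator.
rewrite -!scaler_sumr sumrB -mulmx_sumr -mulmx_suml sumrB HE -/H.
apply: (scalerI n0); rewrite FE opprK mulmxDr mulmxDl.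
by apply/matrixP => i j; rewrite !lin_mxE; field.
Qed.
End JordanMatrix.

(** * Triple derivations of matrices *)

Section TripleMatrix.
Variables (C : numClosedFieldType) (n : nat).
Implicit Types (w a b c x : 'M[C]_n) (p : 'I_n * 'I_n).

Notation E p := (delta_mx p.1 p.2 : 'M[C]_n).
Notation E' p := (delta_mx p.2 p.1 : 'M[C]_n).

Lemma adjD m q (x y : 'M[C]_(m, q)) : (x + y)^t* = x^t* + y^t*.
Proof. by rewrite linearD /= map_mxD. Qed.

Lemma adjZ m q k (x : 'M[C]_(m, q)) : (k *: x)^t* = k^* *: x^t*.
Proof. by rewrite linearZ /= map_mxZ. Qed.

Lemma adj_delta m q (i : 'I_m) (j : 'I_q) :
  (delta_mx i j)^t* = delta_mx j i :> 'M[C]_(q, m).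
Proof. by rewrite trmx_delta map_delta_mx. Qed.

Lemma adj_scalar k : (k%:M)^t* = (k^*)%:M :> 'M[C]_n.
Proof. by rewrite tr_scalar_mx map_scalar_mx. Qed.

Lemma adj_sum I (r : seq I) m q (x : I -> 'M[C]_(m, q)) :
  (\sum_(i <- r) x i)^t* = \sum_(i <- r) (x i)^t*.
Proof. by rewrite linear_sum /= map_mx_sum. Qed.

Lemma adjB m q (x y : 'M[C]_(m, q)) : (x - y)^t* = x^t* - y^t*.
Proof. by rewrite linearB /= map_mxB. Qed.

Lemma adj_mul m q r (x : 'M[C]_(m, q)) (y : 'M[C]_(q, r)) :
  (x *m y)^t* = y^t* *m x^t*.
Proof. by rewrite trmx_mul map_mxM. Qed.

Lemma mxtrace_adj x : \tr (x^t*) = (\tr x)^*.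
Proof. by rewrite /mxtrace rmorph_sum; apply: eq_bigr => i _; rewrite !mxE. Qed.

Definition tmul a b c : 'M[C]_n := 2^-1 *: (a *m b^t* *m c + c *m b^t* *m a).

Lemma tmulC a b c : tmul a b c = tmul c b a.
Proof. by rewrite /tmul addrC. Qed.

Lemma tmulZl k a b c : tmul (k *: a) b c = k *: tmul a b c.
Proof.
by rewrite /tmul -!scalemxAl -scalemxAr -scalerDr scalerA mulrC -scalerA.
Qed.

Lemma tmulZm k a b c : tmul a (k *: b) c = k^* *: tmul a b c.
Proof.
rewrite /tmul adjZ -!scalemxAr -!scalemxAl -scalerDr scalerA mulrC.
by rewrite -scalerA.
Qed.

Lemma adj_tmul a b c :
  (tmul a b c)^t* = 2^-1 *: (a^t* *m b *m c^t* + c^t* *m b *m a^t*).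
Proof.
rewrite adjZ fmorphV rmorph_nat adjD !adj_mul !trmxCK !mulmxA.
by rewrite [X in _ *: X]addrC.
Qed.

(** For the Hilbert-Schmidt pairing [\tr (w^t* *m x)], the operator [tmul a b] is
    adjoint to [tmul b a]; hence [mxtrace_tmul_outer], and likewise the next
    lemma. Together they say that the pairing turns the module products of the
    dual into the triple product itself. *)
Lemma mxtrace_tmul_outer w b a x :
  \tr (w^t* *m tmul b a x) = \tr ((tmul w b a)^t* *m x).
Proof.
rewrite adj_tmul -scalemxAr -scalemxAl !mxtraceZ mulmxDl mulmxDr !raddfD /=.
congr (_ * (_ + _)); first by rewrite !mulmxA.
by rewrite -!mulmxA mxtrace_mulC -!mulmxA mxtrace_mulC -!mulmxA.
Qed.

Lemma mxtrace_tmul_inner w a b x :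
  (\tr (w^t* *m tmul a x b))^* = \tr ((tmul a w b)^t* *m x).
Proof.
rewrite -mxtrace_adj adj_mul trmxCK !adj_tmul -!scalemxAl !mxtraceZ.
rewrite !mulmxDl !raddfD /= addrC; congr (_ * (_ + _)).
  by rewrite -!mulmxA mxtrace_mulC -!mulmxA mxtrace_mulC -!mulmxA.
by rewrite -!mulmxA mxtrace_mulC -!mulmxA mxtrace_mulC -!mulmxA.
Qed.

Variable F : {linear 'M[C]_n -> 'M[C]_n}.
Hypothesis n_gt0 : (0 < n)%N.
Hypothesis F_tmul : forall a b c,
  F (tmul a b c) = tmul (F a) b c + tmul a (F b) c + tmul a b (F c).

Let F_triple a b c :
  F (a *m b^t* *m c + c *m b^t* *m a) =
  F a *m b^t* *m c + c *m b^t* *m F a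
  + a *m (F b)^t* *m c + c *m (F b)^t* *m a
  + a *m b^t* *m F c + F c *m b^t* *m a.
Proof.
have two0 : 2%:R != 0 :> C by rewrite pnatr_eq0.
apply: (scalerI (invr_neq0 two0)); rewrite -linearZ F_tmul /tmul -!scalerDr.
by rewrite !addrA.
Qed.

(** Read off from the derivation rule at [tmul 1 1 1 = 1]. *)
Lemma triple_der1_skew : (F 1%:M)^t* = - F 1%:M.
Proof.
have two0 : 2%:R != 0 :> C by rewrite pnatr_eq0.
have := F_triple 1%:M 1%:M 1%:M.
rewrite adj_scalar conjC1 !mulmx1 !mul1mx linearD => e.
apply: (scalerI two0); apply/matrixP => i j; move/matrixP/(_ i j): e.
rewrite !lin_mxE => e.
by apply: (eq_by_sub (esym e)); ring.
Qed.

(** The derivation rule at [b = 1], where the adjoint of [F 1] is its opposite. *)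
Lemma triple_der_twisted a c : F (a *m c + c *m a) =
    F a *m c + c *m F a + a *m F c + F c *m a
    - a *m F 1%:M *m c - c *m F 1%:M *m a.
Proof.
have := F_triple a 1%:M c; rewrite triple_der1_skew adj_scalar conjC1 !mulmx1 => ->.
rewrite !mulmxN !mulNmx; apply/matrixP => i j; rewrite !lin_mxE.
by ring.
Qed.

Let H := \sum_p F (E p) *m E' p.
Let K := \sum_p E' p *m F (E p).

Let casimir a : H *m a + a *m K = n%:R *: F a + \tr (F 1%:M) *: a.
Proof.
rewrite /K (twisted_derivation_right n_gt0 triple_der_twisted).
rewrite (twisted_derivationE n_gt0 triple_der_twisted a) -/H.
rewrite !(mulmxDr, mulmxN) -scalemxAr mul_mx_scalar.
by apply/matrixP => i j; rewrite !lin_mxE; ring.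
Qed.

Let HtE : H^t* = \sum_p E p *m (F (E p))^t*.
Proof. by rewrite adj_sum; apply: eq_bigr => p _; rewrite adj_mul adj_delta. Qed.

Let KtE : K^t* = \sum_p (F (E p))^t* *m E p.
Proof. by rewrite adj_sum; apply: eq_bigr => p _; rewrite adj_mul adj_delta. Qed.

(** The derivation rule summed over the triples [(E p, E p, a)]: the operators
    [tmul (E p) (E p)] add up to a multiple of the identity, with which [F]
    commutes. *)
Let adj_casimir a : H^t* *m a + a *m K^t* = - (H *m a + a *m K).
Proof.
have : \sum_p F (E p *m E' p *m a + a *m (E' p *m E p)) =
  \sum_p (F (E p) *m E' p *m a + a *m (E' p *m F (E p))
    + E p *m (F (E p))^t* *m a + a *m ((F (E p))^t* *m E p)
    + E p *m E' p *m F a + F a *m (E' p *m E p)).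
  apply: eq_bigr => p _; have := F_triple (E p) (E p) a.
  by rewrite adj_delta !mulmxA.
rewrite -linear_sum !big_split /= -!mulmx_suml -!mulmx_sumr -HtE -KtE -/H -/K.
rewrite sum_deltaK sum_delta'K !mul_scalar_mx !mul_mx_scalar linearD linearZ /=.
move=> e; apply/matrixP => i j; move/matrixP/(_ i j): e; rewrite !lin_mxE => e.
by apply: (eq_by_sub (esym e)); ring.
Qed.

(** By [adj_casimir] the two halves of the sum coincide, and [casimir] computes
    them. The excess [\tr (F 1%:M) *: a] is removed by the last term: [s] is
    imaginary because [F 1%:M] is skew-adjoint, so the two scalar operators
    reinforce each other instead of cancelling. *)
Lemma triple_derivation_casimir a (s := - (\tr (F 1%:M) / (2 * n%:R))) :
  F a = \sum_p (tmul (E p) (- n%:R^-1 *: F (E p)) a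
                - tmul (- n%:R^-1 *: F (E p)) (E p) a)
        + (tmul s%:M 1%:M a - tmul 1%:M s%:M a).
Proof.
have n0 : n%:R != 0 :> C by rewrite pnatr_eq0 -lt0n.
have sC : s^* = - s.
  rewrite rmorphN rmorphM fmorphV rmorphM !rmorph_nat /= -mxtrace_adj.
  by rewrite triple_der1_skew raddfN mulNr.
have -> : tmul s%:M 1%:M a - tmul 1%:M s%:M a =
          - (\tr (F 1%:M) / n%:R) *: a.
  rewrite /tmul !adj_scalar conjC1 sC !mul1mx !mulmx1.
  rewrite !(mul_scalar_mx, mul_mx_scalar).
  by apply/matrixP => i j; rewrite !lin_mxE /s; field.
have nC : (- n%:R^-1)^* = - n%:R^-1 :> C by rewrite rmorphN fmorphV rmorph_nat.
under eq_bigr => p _ do rewrite tmulZl tmulZm nC -scalerBr.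
rewrite -!scaler_sumr sumrB /tmul -!scaler_sumr !big_split /=.
under [\sum_p a *m _ *m E p]eq_bigr => p _ do rewrite -mulmxA.
under [\sum_p a *m _ *m F _]eq_bigr => p _ do rewrite adj_delta -mulmxA.
under [\sum_p F _ *m _ *m a]eq_bigr => p _ do rewrite adj_delta.
rewrite -!mulmx_suml -!mulmx_sumr -HtE -KtE adj_casimir -/H -/K casimir.
by apply/matrixP => i j; rewrite !lin_mxE; field.
Qed.
End TripleMatrix.

(** * Functionals as matrices *)

Section Density.
Variables (R : realType) (n : nat).
Implicit Types (m x : 'M[R[i]]_n) (phi psi : dual (Mn R n)).

Definition density phi : 'M[R[i]]_n := \matrix_(i, j) phi (delta_mx j i).

Lemma mxtrace_mul_delta m i j : \tr (m *m delta_mx i j) = m j i.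
Proof.
rewrite /mxtrace (bigD1 j) //= big1 ?addr0 => [|k kj].
  rewrite mxE (bigD1 i) //= big1 ?addr0 => [|k ki]; first by rewrite mxE !eqxx mulr1.
  by rewrite mxE (negPf ki) mulr0.
by rewrite mxE big1 // => l _; rewrite mxE (negPf kj) andbF mulr0.
Qed.

Lemma mxtrace_inj m m' : (forall x, \tr (m *m x) = \tr (m' *m x)) -> m = m'.
Proof. by move=> eqt; apply/matrixP => i j; rewrite -!mxtrace_mul_delta eqt. Qed.

Lemma densityE phi x : phi x = \tr (density phi *m x).
Proof.
have phi0 : phi 0 = 0 by rewrite -[X in phi X](scale0r 0) dual_scale mul0r.
have phiD y z : phi (y + z) = phi y + phi z.
  by have := dual_linear phi 1 y z; rewrite !scale1r.
rewrite [in LHS](matrix_sum_delta x) (big_morph _ phiD phi0).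
under eq_bigr => i _ do rewrite (big_morph _ phiD phi0).
rewrite {2}(matrix_sum_delta x) mulmx_sumr raddf_sum /=; apply: eq_bigr => i _.
rewrite mulmx_sumr raddf_sum; apply: eq_bigr => j _ /=.
by rewrite dual_scale -scalemxAr mxtraceZ mxtrace_mul_delta mxE.
Qed.

Lemma density_is_linear k phi psi :
  density (k *: phi + psi) = k *: density phi + density psi.
Proof. by apply/matrixP => i j; rewrite !mxE. Qed.

Definition mxtrace_fun : Mn R n -> R[i]^o := fun x => \tr (x : 'M[R[i]]_n).

(** The operator norm bounds every entry, so the trace is bounded by [n]. *)
Lemma mxtrace_dualP : mxtrace_fun \in @dual_pred R (Mn R n).
Proof.
have lin : linear mxtrace_fun.
  by move=> k x y; rewrite /mxtrace_fun raddfD /= mxtraceZ.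
apply: dual_predP => //.
pose L : {linear Mn R n -> R[i]^o} :=
  HB.pack mxtrace_fun (GRing.isLinear.Build _ _ _ _ mxtrace_fun lin).
have : continuous L; last by [].
apply/linear_bounded_continuous/linear_boundedP.
exists (n%:R); split; first exact: realn.
move=> M nM x; apply: (@le_trans _ _ (n%:R * `|x|)); last first.
  by rewrite ler_wpM2r // ltW.
rewrite /= /mxtrace_fun /mxtrace mulr_natl -[X in _ *+ X]card_ord -sumr_const.
apply: le_trans (ler_norm_sum _ _ _) _; apply: ler_sum => i _.
by rewrite Mn_normE -normcC lecR; exact: opnorm_entry.
Qed.

Definition mxtrace_dual : dual (Mn R n) := Dual mxtrace_dualP.

End Density.

Lemma sum_sub_app (I T : Type) (V : zmodType) (s : seq I) (f g : I -> T -> V)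
    (x : T) :
  (\sum_(i <- s) (f i - g i)) x = \sum_(i <- s) (f i x - g i x).
Proof. by rewrite fct_sumE. Qed.

(** * Weak amenability *)

Section Amenability.
Variables (R : realType) (n : nat).
Implicit Types (a b x : 'M[R[i]]_n).

Notation A := (Mn R n).
Notation E p := (delta_mx p.1 p.2 : 'M[R[i]]_n).
Notation E' p := (delta_mx p.2 p.1 : 'M[R[i]]_n).

Lemma jordan_actE (phi : A -> R[i]^o) m a x :
    (forall y, phi y = \tr (m *m y)) ->
  jordan_act (@Mn_jordan R n) phi a x = \tr (jmul m a *m x).
Proof. by move=> phiE; rewrite /jordan_act phiE -mxtrace_jmul. Qed.

Lemma triple_outerE (phi : A -> R[i]^o) w b a x :
    (forall y, phi y = \tr (w^t* *m y)) ->
  triple_outer (@Mn_triple R n) phi b a x = \tr ((tmul w b a)^t* *m x).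
Proof. by move=> phiE; rewrite /triple_outer phiE -mxtrace_tmul_outer. Qed.

Lemma triple_innerE (phi : A -> R[i]^o) w a b x :
    (forall y, phi y = \tr (w^t* *m y)) ->
  triple_inner (@Mn_triple R n) a phi b x = \tr ((tmul a w b)^t* *m x).
Proof. by move=> phiE; rewrite /triple_inner phiE -mxtrace_tmul_inner. Qed.

Lemma linear_density (D : {linear A -> dual A}) :
  exists F : {linear 'M[R[i]]_n -> 'M[R[i]]_n},
    forall a x, D a x = \tr (F a *m x).
Proof.
pose f (a : 'M[R[i]]_n) : 'M[R[i]]_n := density (D a).
have f_lin : linear f by move=> k a b; rewrite /f linearP density_is_linear.
pose F : {linear 'M[R[i]]_n -> 'M[R[i]]_n} :=
  HB.pack f (GRing.isLinear.Build _ _ _ _ f f_lin).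
by exists F => a x; exact: densityE.
Qed.

Lemma conjugate_linear_density (delta : A -> dual A) :
    (forall (k : R[i]) a b, delta (k *: a + b) = k^* *: delta a + delta b) ->
  exists F : {linear 'M[R[i]]_n -> 'M[R[i]]_n},
    forall a x, delta a x = \tr ((F a)^t* *m x).
Proof.
move=> delta_lin; pose f (a : 'M[R[i]]_n) : 'M[R[i]]_n := (density (delta a))^t*.
have f_lin : linear f.
  by move=> k a b; rewrite /f delta_lin density_is_linear adjD adjZ conjCK.
pose F : {linear 'M[R[i]]_n -> 'M[R[i]]_n} :=
  HB.pack f (GRing.isLinear.Build _ _ _ _ f f_lin).
by exists F => a x; rewrite trmxCK densityE.
Qed.

Theorem Mn_jordan_weakly_amenable :
  (0 < n)%N -> jordan_weakly_amenable (@Mn_jordan R n).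
Proof.
move=> n_gt0 D D_der _; have [F DE] := linear_density D.
have F_jordan a b : F (jmul a b) = jmul (F a) b + jmul (F b) a.
  apply: mxtrace_inj => x; rewrite -DE.
  have /(congr1 (fun f => f x)) := D_der a b; rewrite /= => ->.
  rewrite -[LHS]/(jordan_act (@Mn_jordan R n) (D a) b x
                  + jordan_act (@Mn_jordan R n) (D b) a x).
  rewrite (jordan_actE b x (DE a)) (jordan_actE a x (DE b)).
  by rewrite -mxtraceD -mulmxDl.
exists [seq (- (2 / n%:R) *: D (E p), E' p) | p <- index_enum ('I_n * 'I_n)%type].
move=> a; apply: funext => x; rewrite sum_sub_app big_map /= DE.
rewrite (jordan_derivation_casimir n_gt0 F_jordan a) mulmx_suml raddf_sum /=.
apply: eq_bigr => p _.
have phiE y :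
    (- (2 / n%:R) *: D (E p)) y = \tr (- (2 / n%:R) *: F (E p) *m y).
  by rewrite dualZE DE -scalemxAl mxtraceZ.
rewrite (jordan_actE (E' p) x (fun y => jordan_actE a y phiE)).
rewrite (jordan_actE (jmul (E' p) a) x phiE).
exact: mxtrace_mulBl.
Qed.

Theorem Mn_ternary_weakly_amenable :
  (0 < n)%N -> ternary_weakly_amenable (@Mn_triple R n).
Proof.
move=> n_gt0 delta [delta_lin delta_der] _.
have [F deltaE] := conjugate_linear_density delta_lin.
have F_tmul a b c :
    F (tmul a b c) = tmul (F a) b c + tmul a (F b) c + tmul a b (F c).
  rewrite -[LHS]trmxCK -[RHS]trmxCK; congr (_^t*).
  apply: mxtrace_inj => x; rewrite -deltaE.
  have /(congr1 (fun f => f x)) := delta_der a b c; rewrite /= => ->.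
  rewrite -[LHS]/(triple_outer (@Mn_triple R n) (delta a) b c x
                  + triple_inner (@Mn_triple R n) a (delta b) c x
                  + triple_outer (@Mn_triple R n) (delta c) b a x).
  rewrite (triple_outerE b c x (deltaE a)) (triple_innerE a c x (deltaE b)).
  rewrite (triple_outerE b a x (deltaE c)) (tmulC (F c)).
  by rewrite -!mxtraceD -!mulmxDl -!adjD.
pose s : R[i] := - (\tr (F 1%:M) / (2 * n%:R)).
exists (rcons
  [seq (E p, - n%:R^-1 *: delta (E p)) | p <- index_enum ('I_n * 'I_n)%type]
  (s%:M, mxtrace_dual R n)) => a.
apply: funext => x; rewrite sum_sub_app big_rcons big_map /= deltaE.
rewrite (triple_derivation_casimir n_gt0 F_tmul a) -/s.
rewrite adjD mulmxDl mxtraceD adj_sum mulmx_suml raddf_sum /=.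
congr (_ + _); last first.
  have trE y : mxtrace_dual R n y = \tr (1%:M^t* *m y).
    by rewrite adj_scalar conjC1 mul1mx.
  rewrite (triple_innerE s%:M a x trE) (triple_outerE s%:M a x trE).
  by rewrite adjB mxtrace_mulBl.
apply: eq_bigr => p _.
have phiE y :
    (- n%:R^-1 *: delta (E p)) y = \tr ((- n%:R^-1 *: F (E p))^t* *m y).
  by rewrite dualZE deltaE adjZ -scalemxAl mxtraceZ rmorphN fmorphV rmorph_nat.
rewrite (triple_innerE (E p) a x phiE) (triple_outerE (E p) a x phiE).
by rewrite adjB mxtrace_mulBl.
Qed.
End Amenability.

Theorem proposition4p6 (R : realType) (n : nat) (hn : (0 < n)%N) :
  ternary_weakly_amenable (@Mn_triple R n) /\
  jordan_weakly_amenable (@Mn_jordan R n).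
Proof.
split; first exact: Mn_ternary_weakly_amenable.
exact: Mn_jordan_weakly_amenable.
Qed.
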